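(* Let $p$ be a prime, $n\ge1$, and let $M_n$ be a random matrix in $\mathbb{Z}_p^{n\times n}$ whose entries are independent random variables uniformly distributed in $\mathbb{Z}_p$. Then $$\mathbb{E}\{|\det(M_n)|_p\}=\frac{(p-1)p^n}{p^{n+1}-1}.$$
   Context: Uniformly distributed in $\mathbb{Z}_p$ means distributed according to the Haar probability measure on $\mathbb{Z}_p$. $|\cdot|_p$ is the $p$-adic absolute value (normalized by $|p|_p=p^{-1}$). *)

(* Defs.v *)
From HB Require Import structures.
From mathcomp Require Import all_boot all_order all_algebra.
From mathcomp Require Import all_classical all_reals all_analysis.

Set Implicit Arguments.
Unset Strict Implicit.
Unset Printing Implicit Defensive.

Import Order.TTheory GRing.Theory Num.Theory.

Local Open Scope classical_set_scope.
Local Open Scope ring_scope.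

Definition Zp_reduce (p k : nat) (a : 'Z_(p ^ k.+2)) : 'Z_(p ^ k.+1) :=
  (nat_of_ord a)%:R.

(* Z_p is the inverse limit of the rings Z/p^k, k >= 1.  The levels are shifted
   by one (component k lives in Z/p^(k+1)) because 'Z_1 is Z/2 in MathComp.  All
   the structures below exist for every p : nat, but they are the intended ones
   only for p > 1. *)
Record padic_int (p : nat) := PadicInt {
  residue : forall k : nat, 'Z_(p ^ k.+1);
  residue_compat : forall k : nat, Zp_reduce (residue k.+1) = residue k
}.

Section PadicRing.
Variable p : nat.
Implicit Types x y z : padic_int p.

Lemma padic_intP x y : (forall k, residue x k = residue y k) -> x = y.
Proof.
case: x y => [x hx] [y hy] /= exy.
have {}exy : x = y by apply: functional_extensionality_dep.
by case: _ / exy hy => hy; congr PadicInt; exact: Prop_irrelevance.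
Qed.

HB.instance Definition _ := gen_eqMixin (padic_int p).
HB.instance Definition _ := gen_choiceMixin (padic_int p).

Lemma Zp_modulus_dvd k :
  ((Zp_trunc (p ^ k.+1)).+2 %| (Zp_trunc (p ^ k.+2)).+2)%N.
Proof.
case: p => [|[|q]]; first by rewrite !exp0n.
  by rewrite !exp1n.
by rewrite !Zp_cast ?(ltn_exp2l 0)// [(q.+2 ^ k.+2)%N]expnS dvdn_mull.
Qed.

Lemma natr_modulus k (m : nat) :
  ((m %% (Zp_trunc (p ^ k.+2)).+2)%N)%:R = m%:R :> 'Z_(p ^ k.+1).
Proof. by apply: val_inj; rewrite !Zp_nat /= modn_dvdm// Zp_modulus_dvd. Qed.

Lemma zero_compat k : Zp_reduce (0 : 'Z_(p ^ k.+2)) = 0.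
Proof. by []. Qed.

Lemma one_compat k : Zp_reduce (1 : 'Z_(p ^ k.+2)) = 1.
Proof. exact: (natr_modulus k 1). Qed.

Lemma add_compat x y k :
  Zp_reduce (residue x k.+1 + residue y k.+1)
    = residue x k + residue y k.
Proof. by rewrite /Zp_reduce natr_modulus natrD -/(Zp_reduce _) -/(Zp_reduce _) !residue_compat. Qed.

Lemma mul_compat x y k :
  Zp_reduce (residue x k.+1 * residue y k.+1)
    = residue x k * residue y k.
Proof. by rewrite /Zp_reduce natr_modulus natrM -/(Zp_reduce _) -/(Zp_reduce _) !residue_compat. Qed.

Lemma opp_compat x k :
  Zp_reduce (- residue x k.+1) = - residue x k.
Proof.
apply/eqP; rewrite -addr_eq0 -[X in _ + X]residue_compat /Zp_reduce -natrD.
rewrite -natr_modulus; apply/eqP.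
exact: (congr1 (@Zp_reduce p k) (addNr (residue x k.+1))).
Qed.

Definition padic_zero := PadicInt zero_compat.
Definition padic_one := PadicInt one_compat.
Definition padic_add x y := PadicInt (add_compat x y).
Definition padic_mul x y := PadicInt (mul_compat x y).
Definition padic_opp x := PadicInt (opp_compat x).

Fact padic_addA : associative padic_add.
Proof. by move=> x y z; apply: padic_intP => k; exact: addrA. Qed.
Fact padic_addC : commutative padic_add.
Proof. by move=> x y; apply: padic_intP => k; exact: addrC. Qed.
Fact padic_add0 : left_id padic_zero padic_add.
Proof. by move=> x; apply: padic_intP => k; exact: add0r. Qed.
Fact padic_addN : left_inverse padic_zero padic_opp padic_add.
Proof. by move=> x; apply: padic_intP => k; exact: addNr. Qed.

HB.instance Definition _ := GRing.isZmodule.Build (padic_int p)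
  padic_addA padic_addC padic_add0 padic_addN.

Fact padic_mulA : associative padic_mul.
Proof. by move=> x y z; apply: padic_intP => k; exact: mulrA. Qed.
Fact padic_mulC : commutative padic_mul.
Proof. by move=> x y; apply: padic_intP => k; exact: mulrC. Qed.
Fact padic_mul1 : left_id padic_one padic_mul.
Proof. by move=> x; apply: padic_intP => k; exact: mul1r. Qed.
Fact padic_mulDl : left_distributive padic_mul padic_add.
Proof. by move=> x y z; apply: padic_intP => k; exact: mulrDl. Qed.
Fact padic_one_neq0 : padic_one != 0 :> padic_int p.
Proof. by apply/eqP => /(congr1 (fun x => residue x 0)) /eqP; rewrite oner_eq0. Qed.

HB.instance Definition _ := GRing.Zmodule_isComNzRing.Build (padic_int p)
  padic_mulA padic_mulC padic_mul1 padic_mulDl padic_one_neq0.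

HB.instance Definition _ := isPointed.Build (padic_int p) 0.

(* The p-adic topology: [residue y k = residue x k] says y is in x + p^(k+1) Z_p. *)
Definition padic_open : set_system (padic_int p) :=
  [set U | forall x, U x ->
     exists k, forall y, residue y k = residue x k -> U y].

Lemma padic_residue_le x y j k : (j <= k)%N ->
  residue x k = residue y k -> residue x j = residue y j.
Proof.
move=> /subnK <-; elim: (k - j)%N => [//|i IH].
by rewrite addSn => e; apply: IH; rewrite -(residue_compat x) -(residue_compat y) e.
Qed.

Fact padic_openT : padic_open setT.
Proof. by move=> x _; exists 0%N. Qed.

Fact padic_openI : setI_closed padic_open.
Proof.
move=> U V oU oV x [Ux Vx]; have [j hj] := oU x Ux; have [k hk] := oV x Vx.
exists (maxn j k) => y e; split.
  by apply/hj/(padic_residue_le _ e)/leq_maxl.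
by apply/hk/(padic_residue_le _ e)/leq_maxr.
Qed.

Fact padic_open_bigU (I : Type) (f : I -> set (padic_int p)) :
  (forall i, padic_open (f i)) -> padic_open (\bigcup_i f i).
Proof.
move=> of_ x [i _ fix_]; have [k hk] := of_ i x fix_.
by exists k => y /hk fiy; exists i.
Qed.

HB.instance Definition _ := isOpenTopological.Build (padic_int p)
  padic_openT padic_openI padic_open_bigU.

HB.instance Definition _ := @isMeasurable.Build
  (sigma_display (@open (padic_int p))) (padic_int p)
  <<s @open (padic_int p) >> (@sigma_algebra0 _ setT _)
  (@sigma_algebraC _ _) (@sigma_algebra_bigcup _ setT _).

End PadicRing.

(* For x != 0 and p > 1 there is exactly one such k; see padic_valP. *)
Definition padic_val (p : nat) (x : padic_int p) : nat :=
  get [set k | (exists y, x = p%:R ^+ k * y) /\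
               ~ (exists y, x = p%:R ^+ k.+1 * y)].

Lemma residue_nat (p k m : nat) : residue (m%:R : padic_int p) k = m%:R.
Proof. by elim: m => // m IH; rewrite -!natr1 -IH. Qed.

Lemma padic_valP (p : nat) (x : padic_int p) : (1 < p)%N -> x != 0 ->
  (exists y, x = p%:R ^+ padic_val x * y) /\
  ~ (exists y, x = p%:R ^+ (padic_val x).+1 * y).
Proof.
move=> p1 x0; rewrite /padic_val.
set E := (X in get X).
suff: exists k, E k by move=> /getPex.
apply: contrapT => H.
have D k : exists y, x = p%:R ^+ k * y.
  elim: k => [|k IH]; first by exists x; rewrite expr0 mul1r.
  by apply: contrapT => N; apply: H; exists k.
case/eqP: x0; apply: padic_intP => k; have [y ->] := D k.+1.
rewrite -natrX -[residue _ k]/(residue _ k * residue y k) residue_nat.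
by rewrite pchar_Zp ?mul0r// (ltn_exp2l 0).
Qed.

Definition padic_abs (R : realType) (p : nat) (x : padic_int p) : R :=
  if x == 0 then 0 else p%:R ^- padic_val x.

(* A translation-invariant Borel probability measure on the compact additive
   group Z_p: by uniqueness, the Haar probability measure. *)
Definition is_haar_probability (R : realType) (p : nat)
    (mu : probability (padic_int p) R) : Prop :=
  forall (a : padic_int p) (A : set (padic_int p)), measurable A ->
    mu [set a + x | x in A] = mu A.

Definition uniform_padic (R : realType) (p : nat) (d : measure_display)
    (T : measurableType d) (P : probability T R)
    (X : {RV P >-> padic_int p}) : Prop :=
  is_haar_probability (distribution P X).

Definition mutually_independent (R : realType) (d d' : measure_display)
    (T : measurableType d) (T' : measurableType d') (P : probability T R)
    (I : finType) (X : I -> {RV P >-> T'}) : Prop :=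
  forall (J : {set I}) (B : I -> set T'), (forall i, measurable (B i)) ->
    P (\bigcap_(i in [set` J]) (X i @^-1` B i))
      = (\prod_(i in J) P (X i @^-1` B i))%E.

(* Main.v *)
(* Write q = 1/p.  The first column of M is divisible by p with probability
   q^n.  In that case it is p times a uniform column, so that |det M| is
   distributed like q |det M'| with M' uniform of size n.  Otherwise the column
   extends to an invertible matrix, and |det M| is distributed like |det M'|
   with M' uniform of size n-1.  Hence E_n = (1 - q^n) E_(n-1) + q^(n+1) E_n,
   which together with E_0 = 1 gives the formula.
   To work with finite sums only, |x| is replaced by its truncation
   [p^j does not divide x] |x|, a function of x mod p^j; the truncated means
   satisfy E_(n,j+1) = (1 - q^n) E_(n-1,j+1) + q^(n+1) E_(n,j), whence
   |E_n - E_(n,j)| <= q^j, and the theorem follows by monotone convergence. *)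

Require Import Defs.
From HB Require Import structures.
From mathcomp Require Import all_boot all_order all_algebra perm.
From mathcomp Require Import all_classical all_reals all_analysis.
From mathcomp Require Import measurable_realfun ring lra zify.

Set Implicit Arguments.
Unset Strict Implicit.
Unset Printing Implicit Defensive.

Import Order.TTheory GRing.Theory Num.Theory numFieldNormedType.Exports.

Local Open Scope ring_scope.

(** * The truncated absolute value on residue rings *)

Section TruncatedAbs.
Variables (R : realType) (p : nat).
Hypothesis p_prime : prime p.

(* At most one term is nonzero: the value is |a|_p, or 0 if p^j divides a.  The
   argument is a natural number so that one definition serves all the rings
   Z/p^k. *)
Definition trunc_abs (j a : nat) : R :=
  \sum_(i < j) ((p ^ i %| a)%N && ~~ (p ^ i.+1 %| a)%N)%:R * p%:R ^- i.

Lemma trunc_abs_ge0 j a : 0 <= trunc_abs j a.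
Proof. by apply: sumr_ge0 => i _; rewrite mulr_ge0// invr_ge0 exprn_ge0. Qed.

(** Only divisibility by p^i with i <= j is tested, and this depends on the residue mod p^K alone;
    products in Z/p^K may thus be computed on representatives. *)
Lemma eq_mod_trunc_abs K j a b : (j <= K)%N -> a = b %[mod p ^ K] ->
  trunc_abs j a = trunc_abs j b.
Proof.
move=> jK ab; have dv i : (i <= K)%N -> (p ^ i %| a)%N = (p ^ i %| b)%N.
  by move=> iK; rewrite /dvdn -(modn_dvdm a (dvdn_exp2l p iK)) ab modn_dvdm ?dvdn_exp2l.
by apply: eq_bigr => i _; rewrite !dv// (leq_trans _ jK)// ltnW.
Qed.

(** The term i = 0 vanishes and the others shift by one. This shift is what lowers the truncation
    level in the recurrence. *)
Lemma trunc_absMp j a : trunc_abs j.+1 (p * a) = p%:R^-1 * trunc_abs j a.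
Proof.
rewrite /trunc_abs big_ord_recl /= expn1 (dvdn_mulr a (dvdnn p)) andbF mul0r add0r.
rewrite mulr_sumr.
apply: eq_bigr => i _; rewrite /bump leq0n add1n !(expnS p) !dvdn_pmul2l ?prime_gt0// -!expnS.
by rewrite exprS invfM mulrCA.
Qed.

Lemma trunc_absMu j u a : coprime p u -> trunc_abs j (u * a) = trunc_abs j a.
Proof. by move=> pu; apply: eq_bigr => i _; rewrite !Gauss_dvdr ?coprimeXl. Qed.

Lemma trunc_abs1 j : trunc_abs j.+1 1 = 1.
Proof.
rewrite /trunc_abs big_ord_recl /= expn1 dvdn1 gtn_eqF ?prime_gt1// mul1r invr1.
rewrite big1 ?addr0// => i _.
by rewrite /bump leq0n add1n dvdn1 -(exp1n i.+1) eqn_exp2r// gtn_eqF ?prime_gt1//= mul0r.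
Qed.

Variable K : nat.
Notation Z := 'Z_(p ^ K.+1).

Lemma Zpow_modulusE : (Zp_trunc (p ^ K.+1)).+2 = (p ^ K.+1)%N.
Proof. by rewrite Zp_cast// (ltn_exp2l 0) ?prime_gt1. Qed.

Lemma card_Zpow : #|Z| = (p ^ K.+1)%N.
Proof. by rewrite card_ord Zpow_modulusE. Qed.

Lemma val_Zpow_nat m : nat_of_ord (m%:R : Z) = (m %% p ^ K.+1)%N.
Proof. by rewrite Zp_nat /= Zpow_modulusE. Qed.

Lemma Zpow_mod_val m : nat_of_ord (m%:R : Z) = m %[mod p ^ K.+1].
Proof. by rewrite val_Zpow_nat modn_mod. Qed.

Lemma val_Zpow_mul (x y : Z) : nat_of_ord (x * y) = (x * y)%N %[mod p ^ K.+1].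
Proof.
have -> : nat_of_ord (x * y) = ((x * y) %% (Zp_trunc (p ^ K.+1)).+2)%N by [].
by move: (x * y)%N => m; rewrite Zpow_modulusE modn_mod.
Qed.

Lemma trunc_abs_ZM j (x y : Z) : (j <= K.+1)%N ->
  trunc_abs j (x * y : Z)%R = trunc_abs j (x * y)%N.
Proof. by move=> jK; apply: (eq_mod_trunc_abs jK); exact: val_Zpow_mul. Qed.

Lemma trunc_abs_pZ j (x : Z) : (j <= K)%N ->
  trunc_abs j.+1 (p%:R * x : Z)%R = p%:R^-1 * trunc_abs j x.
Proof.
move=> jK; rewrite -trunc_absMp; apply: (@eq_mod_trunc_abs K.+1) => //.
by rewrite val_Zpow_mul -modnMml Zpow_mod_val modnMml.
Qed.

Lemma unit_Zpow (x : Z) : (x \is a GRing.unit) = coprime p x.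
Proof.
by rewrite -[x in LHS]natr_Zp unitZpE ?coprime_pexpl// (ltn_exp2l 0) ?prime_gt1.
Qed.

Lemma trunc_abs_unitM j (u x : Z) : (j <= K.+1)%N -> u \is a GRing.unit ->
  trunc_abs j (u * x : Z)%R = trunc_abs j x.
Proof. by move=> jK uU; rewrite trunc_abs_ZM// trunc_absMu// -unit_Zpow. Qed.

Lemma nonunit_Zpow (x : Z) : x \isn't a GRing.unit -> exists y : Z, x = p%:R * y.
Proof.
rewrite unit_Zpow prime_coprime// negbK => /dvdnP[m xE]; exists m%:R.
by rewrite -natrM mulnC -xE natr_Zp.
Qed.

Lemma pZ_nonunit (x : Z) : p%:R * x \isn't a GRing.unit.
Proof.
rewrite unitrM negb_and unit_Zpow; apply/orP; left.
rewrite prime_coprime// negbK.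
have pK : (p %| p ^ K.+1)%N by rewrite expnS dvdn_mulr.
by rewrite /dvdn -(modn_dvdm _ pK) Zpow_mod_val modn_dvdm// modnn.
Qed.

(** The nonunits are the multiples p * i with i < p^K. *)
Lemma card_nonunit_Zpow : #|[pred x : Z | x \isn't a GRing.unit]| = (p ^ K)%N.
Proof.
have lt (i : 'I_(p ^ K)) : (p * i < (Zp_trunc (p ^ K.+1)).+2)%N.
  by rewrite Zpow_modulusE expnS ltn_pmul2l ?prime_gt0.
pose f (i : 'I_(p ^ K)) : Z := Ordinal (lt i).
have fI : injective f.
  move=> i k /(congr1 val) /= /eqP; rewrite eqn_pmul2l ?prime_gt0// => /eqP; exact: val_inj.
rewrite -[RHS]card_ord -(fintype.card_image fI); apply: eq_card => x.
rewrite inE unit_Zpow prime_coprime// negbK; apply/idP/fintype.imageP.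
  move=> /dvdnP[m xE]; have mK : (m < p ^ K)%N.
    by have := ltn_ord x; rewrite xE Zpow_modulusE expnS mulnC ltn_pmul2l ?prime_gt0.
  by exists (Ordinal mK) => //; apply: val_inj; rewrite /= xE mulnC.
by move=> [i _ ->] /=; rewrite dvdn_mulr.
Qed.

End TruncatedAbs.

(** * Determinants of uniform matrices over a residue ring *)

Lemma sum_row_mx (V : nmodType) (Z : finType) m n1 n2 (F : 'M[Z]_(m, n1 + n2) -> V) :
  \sum_A F A = \sum_(B : 'M[Z]_(m, n1)) \sum_(C : 'M[Z]_(m, n2)) F (row_mx B C).
Proof.
rewrite pair_big /= (reindex (fun u : 'M[Z]_(m, n1) * 'M[Z]_(m, n2) => row_mx u.1 u.2)) //=.
exists (fun A => (lsubmx A, rsubmx A)) => [[B C]|A] _ /=.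
  by rewrite row_mxKl row_mxKr.
by rewrite hsubmxK.
Qed.

Lemma sum_col_mx (V : nmodType) (Z : finType) m1 m2 n (F : 'M[Z]_(m1 + m2, n) -> V) :
  \sum_A F A = \sum_(B : 'M[Z]_(m1, n)) \sum_(C : 'M[Z]_(m2, n)) F (col_mx B C).
Proof.
rewrite pair_big /= (reindex (fun u : 'M[Z]_(m1, n) * 'M[Z]_(m2, n) => col_mx u.1 u.2)) //=.
exists (fun A => (usubmx A, dsubmx A)) => [[B C]|A] _ /=.
  by rewrite col_mxKu col_mxKd.
by rewrite vsubmxK.
Qed.

(** Over the local ring Z/p^(K+1) this means that the column is not divisible by p. A unit entry is
    what the completion to an invertible matrix uses. *)
Definition unimodular (Z : unitRingType) m (c : 'cV[Z]_m) : bool :=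
  [exists i, c i 0 \is a GRing.unit].

(** Swapping the unit entry to the top and appending the columns e_2, ..., e_(n+1) gives a lower
    triangular matrix with unit determinant; the swap is then undone. *)
Lemma unimodular_completion (Z : comUnitRingType) n (c : 'cV[Z]_(1 + n)) :
  unimodular c -> exists B : 'M[Z]_(1 + n, n), row_mx c B \in unitmx.
Proof.
move=> /existsP[i ci].
pose D : 'M[Z]_(1 + n, n) := col_mx 0 1%:M.
pose c' : 'cV[Z]_(1 + n) := row_perm (tperm 0 i) c.
pose G : 'M[Z]_(1 + n) := row_mx c' D.
have GU : G \in unitmx.
  rewrite unitmxE /G -[c']vsubmxK -block_mxEh det_lblock det1 mulr1 det_mx11.
  by rewrite !mxE lshift0 tpermL.
exists (row_perm (tperm 0 i) D).
have -> : row_mx c (row_perm (tperm 0 i) D) = tperm_mx 0 i *m G.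
  rewrite mul_mx_row -!row_permE; congr row_mx.
  by apply/matrixP => k l; rewrite !mxE tpermK.
by rewrite unitmx_mul unitmx_perm.
Qed.

(** * The recurrence for the truncated means and its limit *)

Section MatrixRecurrence.
Variables (R : realType) (p K : nat).
Hypothesis p_prime : prime p.
Notation Z := 'Z_(p ^ K.+1).

Let p_gt0 : (0 : R) < p%:R. Proof. by rewrite ltr0n prime_gt0. Qed.
Let p_neq0 : p%:R != 0 :> R. Proof. exact: lt0r_neq0. Qed.

Lemma card_not_unimodular m :
  #|[pred c : 'cV[Z]_m | ~~ unimodular c]| = (p ^ (K * m))%N.
Proof.
rewrite expnM -(card_nonunit_Zpow p_prime K) -[in RHS](card_ord m) -card_ffun_on.
pose h (f : {ffun 'I_m -> Z}) : 'cV[Z]_m := \col_i f i.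
have hI : injective h.
  by move=> f g /matrixP E; apply/ffunP => i; have := E i 0; rewrite !mxE.
rewrite -(fintype.card_image hI); apply: eq_card => c; rewrite !inE.
apply/idP/fintype.imageP => [|[f /ffun_onP fU ->]].
  rewrite negb_exists => /forallP cU; exists [ffun i => c i 0].
    by apply/ffun_onP => i; rewrite ffunE inE.
  by apply/matrixP => i j; rewrite !mxE ffunE ord1.
by rewrite negb_exists; apply/forallP => i; rewrite mxE; exact: fU.
Qed.

(** Multiplication by p maps the columns onto the non-unimodular ones, and its fibres, being cosets
    of the kernel, all have the same size. So p times a uniform column is uniform among the columns
    divisible by p. *)
Lemma sum_scale_col m (f : 'cV[Z]_m -> R) :
  \sum_c f (p%:R *: c) = p%:R ^+ m * \sum_(c | ~~ unimodular c) f c.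
Proof.
pose k := #|[pred x : 'cV[Z]_m | p%:R *: x == 0]|.
have E (g : 'cV[Z]_m -> R) : \sum_c g (p%:R *: c) = k%:R * \sum_(c | ~~ unimodular c) g c.
  rewrite (partition_big (fun c : 'cV[Z]_m => p%:R *: c) (fun c => ~~ unimodular c)) /=.
    rewrite mulr_sumr; apply: eq_bigr => y; rewrite negb_exists => /forallP yU.
    have [x0 yE] : exists x0 : 'cV[Z]_m, y = p%:R *: x0.
      have s i : {z : Z | y i 0 == p%:R * z}.
        by apply: sigW; have [z ->] := nonunit_Zpow p_prime (yU i); exists z.
      exists (\col_i sval (s i)); apply/matrixP => i j.
      by rewrite !mxE ord1; case: (s i) => z /= /eqP.
    under eq_bigr => x /eqP -> do over.
    rewrite sumr_const mulr_natl; congr (_ *+ _).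
    (* The fibre over p * x0 is the kernel translated by x0. *)
    rewrite yE /k -[RHS](fintype.card_image (addIr x0)); apply: eq_card => x.
    apply/idP/fintype.imageP => [xE|[z zE ->]].
      have {}xE : p%:R *: x = p%:R *: x0 by exact/eqP.
      by exists (x - x0); rewrite ?subrK// inE scalerBr xE subrr.
    have {}zE : p%:R *: z = 0 by exact/eqP.
    suff : p%:R *: (z + x0) == p%:R *: x0 by [].
    by rewrite scalerDr zE add0r eqxx.
  move=> c _; rewrite negb_exists; apply/forallP => i; rewrite mxE; exact: pZ_nonunit.
rewrite E; congr (_ * _).
(* The kernel size [k] is found by counting: the case f = 1 gives p^((K+1)m) = k p^(Km). *)
have := E (fun=> 1); rewrite !sumr_const card_not_unimodular card_mx card_Zpow// muln1.
rewrite -expnM mulSn expnD natrM !natrX.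
move=> H; apply: (@mulIf _ (p%:R ^+ (K * m))); first by rewrite expf_neq0.
by rewrite H.
Qed.

Lemma sum_unimodular m :
  \sum_(c : 'cV[Z]_m | unimodular c) (1 : R) = ((p ^ K.+1) ^ m)%:R - (p ^ (K * m))%:R.
Proof.
have : \sum_(c : 'cV[Z]_m) (1 : R) = ((p ^ K.+1) ^ m)%:R.
  by rewrite sumr_const card_mx card_Zpow// muln1.
rewrite (bigID (@unimodular Z m)) /= => <-.
by rewrite sumr_const [X in _ + X - _]sumr_const card_not_unimodular addrK.
Qed.

Definition det_sum n j : R := \sum_(A : 'M[Z]_n) trunc_abs R p j (\det A).

(** The exponent n+2 collects n+1 from the fibres of multiplication by p on columns of length n+1,
    and 1 from the factor p that leaves the determinant. *)
Lemma sum_not_unimodular n j : (j <= K)%N ->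
  \sum_(c : 'cV[Z]_(1 + n) | ~~ unimodular c) \sum_(B : 'M[Z]_(1 + n, n))
     trunc_abs R p j.+1 (\det (row_mx c B : 'M[Z]_(1 + n)))
  = p%:R ^- n.+2 * det_sum n.+1 j.
Proof.
move=> jK; apply: (@mulfI _ (p%:R ^+ n.+1)); first by rewrite expf_neq0.
rewrite -sum_scale_col /det_sum (@sum_row_mx _ _ n.+1 1 n) mulrA.
rewrite [p%:R ^+ n.+2]exprSr invfM mulVKf ?expf_neq0//.
rewrite mulr_sumr; apply: eq_bigr => c _; rewrite mulr_sumr; apply: eq_bigr => B _.
rewrite -trunc_abs_pZ//; congr trunc_abs; congr nat_of_ord.
have -> : row_mx (p%:R *: c) B = row_mx c B *m block_mx p%:R%:M 0 0 1%:M.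
  by rewrite mul_row_block !mulmx0 addr0 add0r mulmx1 mul_mx_scalar.
by rewrite det_mulmx det_ublock det1 mulr1 det_scalar expr1 mulrC.
Qed.

(** Let G be an invertible completion of c. Substituting G B for B turns the matrix into G times one
    with first column e_1, whose determinant ignores the top row of B; that free row contributes the
    factor (p^(K+1))^n. *)
Lemma sum_unimodular_det n j (c : 'cV[Z]_(1 + n)) : (j <= K.+1)%N -> unimodular c ->
  \sum_(B : 'M[Z]_(1 + n, n)) trunc_abs R p j (\det (row_mx c B : 'M[Z]_(1 + n)))
  = (p ^ K.+1)%:R ^+ n * det_sum n j.
Proof.
move=> jK /unimodular_completion[B0 GU].
pose G : 'M[Z]_(1 + n) := row_mx c B0.
have GK B : row_mx c (G *m B) = G *m row_mx (col_mx 1%:M 0) B.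
  by rewrite mul_mx_row /G mul_row_col mulmx1 mulmx0 addr0.
rewrite (reindex (fun B => G *m B)) /=; last first.
  by exists (mulmx (invmx G)) => B _; rewrite ?mulKmx ?mulKVmx.
under eq_bigr => B _ do rewrite GK det_mulmx trunc_abs_unitM//.
rewrite sum_col_mx; under eq_bigr => B _ do under eq_bigr => C _ do
  rewrite -block_mxEh det_ublock det1 mul1r.
by rewrite sumr_const card_mx card_Zpow// mul1n -natrX mulr_natl.
Qed.

Lemma det_sumS n j : (j <= K)%N ->
  det_sum n.+1 j.+1 =
    (((p ^ K.+1) ^ n.+1)%:R - (p ^ (K * n.+1))%:R) * ((p ^ K.+1)%:R ^+ n * det_sum n j.+1)
    + p%:R ^- n.+2 * det_sum n.+1 j.
Proof.
move=> jK; rewrite {1}/det_sum (@sum_row_mx _ _ n.+1 1 n) (bigID (@unimodular Z n.+1)) /=.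
rewrite sum_not_unimodular//; congr (_ + _).
rewrite -sum_unimodular mulr_suml; apply: eq_bigr => c cU.
by rewrite mul1r sum_unimodular_det.
Qed.

Definition det_mean n j : R := det_sum n j / (p ^ K.+1)%:R ^+ (n * n).

Lemma det_mean_dim0 j : det_mean 0 j.+1 = 1.
Proof.
rewrite /det_mean muln0 divr1 /det_sum.
under eq_bigr => A _ do rewrite det_mx00.
by rewrite sumr_const card_mx muln0 (trunc_abs1 _ p_prime).
Qed.

Lemma det_mean_level0 n : det_mean n 0 = 0.
Proof. by rewrite /det_mean /det_sum big1 ?mul0r// => A _; rewrite /trunc_abs big_ord0. Qed.

Lemma det_meanS n j : (j <= K)%N ->
  det_mean n.+1 j.+1 =
    (1 - p%:R ^- n.+1) * det_mean n j.+1 + p%:R ^- n.+2 * det_mean n.+1 j.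
Proof.
move=> jK; rewrite /det_mean det_sumS// !natrX.
set t : R := p%:R; set a := t ^+ K.+1.
(* Of the a^(n+1) columns, a fraction p^-(n+1) is not unimodular. *)
have -> : t ^+ (K * n.+1) = a ^+ n.+1 / t ^+ n.+1.
  by rewrite exprM /a (exprSr t K) exprMn mulfK ?expf_neq0.
have -> : a ^+ (n.+1 * n.+1) = a ^+ (n * n) * a ^+ n * a ^+ n.+1.
  by rewrite -!exprD; congr (_ ^+ _); lia.
have t0 : t != 0 by [].
have a0 m : a ^+ m != 0 by rewrite !expf_neq0.
move: (a0 (n * n)%N) (a0 n) (a0 n.+1) (expf_neq0 n.+1 t0) (expf_neq0 n.+2 t0).
move: (a ^+ (n * n)) (a ^+ n) (a ^+ n.+1) (t ^+ n.+1) (t ^+ n.+2) => b c e u v.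
by move=> b0 c0 e0 u0 v0; field; rewrite b0 c0 e0 u0 v0.
Qed.

Definition det_limit n : R := (p%:R - 1) * p%:R ^+ n / (p%:R ^+ n.+1 - 1).

Let pX_gt1 n : 1 < p%:R ^+ n.+1 :> R.
Proof. by rewrite exprn_egt1// ltr1n prime_gt1. Qed.

(** This is the recurrence of [det_meanS] without the truncation levels, so the error [det_limit] -
    [det_mean] obeys the same linear recurrence. *)
Lemma det_limitS n :
  det_limit n.+1 = (1 - p%:R ^- n.+1) * det_limit n + p%:R ^- n.+2 * det_limit n.+1.
Proof.
rewrite /det_limit; have := pX_gt1 n.+1; have := pX_gt1 n; have := p_neq0.
rewrite !exprS; have := expf_neq0 n p_neq0.
move: (p%:R : R) => t; move: (t ^+ n) => u u0 t0 H1 H2.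
have H1' : t * u - 1 != 0 by rewrite subr_eq0 gt_eqF.
have H2' : t * (t * u) - 1 != 0 by rewrite subr_eq0 gt_eqF.
by field; rewrite u0 t0 H1' H2'.
Qed.

(* The bound is stable because (1 - q^(n+1)) q^(j+1) + q^(n+2) q^j = q^(j+1). *)
Lemma det_mean_bound n j : (j <= K.+1)%N -> `|det_limit n - det_mean n j| <= p%:R ^- j.
Proof.
elim: j n => [|j IHj] n jK.
  rewrite det_mean_level0 subr0 expr0 invr1 /det_limit exprS.
  have := pX_gt1 n; rewrite exprS.
  have : 1 <= p%:R ^+ n :> R by rewrite exprn_ege1// ler1n prime_gt0.
  move: (p%:R ^+ n : R) => u u1 H.
  have t1 : 1 <= p%:R :> R by rewrite ler1n prime_gt0.
  rewrite ger0_norm ?ler_pdivrMr ?divr_ge0 ?mulr_ge0 ?subr_ge0//; lra.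
(* The recurrence calls size n at the same level j+1 and size n+1 at level j, hence an induction on
   n inside the one on j. *)
elim: n => [|n IHn].
  rewrite det_mean_dim0 /det_limit expr0 expr1 mulr1 divff ?subrr ?normr0 ?invr_ge0 ?exprn_ge0//.
  by rewrite subr_eq0 gt_eqF// ltr1n prime_gt1.
rewrite det_meanS// det_limitS opprD addrACA -!mulrBr (le_trans (ler_normD _ _))// !normrM.
have q0 m : 0 <= p%:R ^- m :> R by rewrite invr_ge0 exprn_ge0.
have q1 : p%:R ^- n.+1 <= 1 :> R by rewrite invf_le1 ?exprn_gt0// ltW.
rewrite [`|1 - _|]ger0_norm ?subr_ge0// [`|p%:R ^- _|]ger0_norm//.
apply: (le_trans (lerD (ler_wpM2l _ IHn) (ler_wpM2l (q0 _) (IHj n.+1 (ltnW jK))))).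
  by rewrite subr_ge0.
have -> : p%:R ^- n.+2 * p%:R ^- j = p%:R ^- n.+1 * p%:R ^- j.+1 :> R.
  by rewrite -!invfM -!exprD addSnnS.
by rewrite -mulrDl subrK mul1r.
Qed.
End MatrixRecurrence.

(** * Valuations and residues of p-adic integers *)

(** Taking k first makes each level a function that can carry a ring morphism structure, and so
    commute with determinants. *)
Definition padic_residue p k (x : padic_int p) : 'Z_(p ^ k.+1) := residue x k.

Fact padic_residue_zmod p k : zmod_morphism (@padic_residue p k).
Proof. by []. Qed.

Fact padic_residue_monoid p k : monoid_morphism (@padic_residue p k).
Proof. by []. Qed.

HB.instance Definition _ p k :=
  GRing.isZmodMorphism.Build _ _ (@padic_residue p k) (@padic_residue_zmod p k).
HB.instance Definition _ p k :=
  GRing.isMonoidMorphism.Build _ _ (@padic_residue p k) (@padic_residue_monoid p k).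

Section Valuation.
Variables (R : realType) (p : nat).
Hypothesis p_prime : prime p.
Implicit Types x y : padic_int p.

Let p_gt1 : (1 < p)%N. Proof. exact: prime_gt1. Qed.

Lemma residue_modn x k : nat_of_ord (residue x k) = (residue x k.+1 %% p ^ k.+1)%N.
Proof. by rewrite -(residue_compat x k) /Zp_reduce val_Zpow_nat. Qed.

Lemma eq_Zpow k (a b : 'Z_(p ^ k.+1)) : a = b %[mod p ^ k.+1] -> a = b.
Proof.
have lt (c : 'Z_(p ^ k.+1)) : (c < p ^ k.+1)%N.
  by have := ltn_ord c; rewrite [X in (_ < X)%N]Zpow_modulusE.
by rewrite !modn_small// => /val_inj.
Qed.

Lemma residue0_dvd x k : (p %| residue x k)%N -> residue x 0 = 0.
Proof.
elim: k => [|k IH] px; last by apply: IH; rewrite residue_modn /dvdn modn_dvdm// expnS dvdn_mulr.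
by apply: eq_Zpow; rewrite mod0n; apply/eqP.
Qed.

Lemma padic_divp x : residue x 0 = 0 -> exists y, x = p%:R * y.
Proof.
move=> x0.
have dv k : (p %| residue x k)%N.
  elim: k => [|k IH]; first by rewrite x0 dvdn0.
  by move: IH; rewrite residue_modn /dvdn modn_dvdm// expnS dvdn_mulr.
(* Dividing by p loses one digit, so component k of the quotient is read off component k+1 of x. *)
pose h k : 'Z_(p ^ k.+1) := ((residue x k.+1 : nat) %/ p)%:R.
have hc k : Zp_reduce (h k.+1) = h k.
  rewrite /h /Zp_reduce; apply: eq_Zpow; rewrite !val_Zpow_nat// !modn_mod modn_dvdm ?dvdn_exp2l//.
  rewrite (residue_modn x k.+1); have /dvdnP[m ->] := dv k.+2.
  by rewrite (expnS p k.+1) [(m * p)%N]mulnC -muln_modr !mulKn ?prime_gt0// modn_mod.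
exists (PadicInt hc); apply: padic_intP => k.
rewrite -[RHS]/(residue p%:R k * h k) residue_nat /h -natrM mulnC divnK//.
by apply: eq_Zpow; rewrite Zpow_mod_val// residue_modn modn_mod.
Qed.

(** Level k knows x mod p^(k+1), hence the bound on i. Factors p are extracted one at a time: if x =
    p^i y and p^(i+1) divides the residue of x, then p divides that of y. *)
Lemma dvdn_residueP i k x : (i <= k.+1)%N ->
  reflect (exists y, x = p%:R ^+ i * y) (p ^ i %| residue x k)%N.
Proof.
move=> ik.
have mulE j y : (residue (p%:R ^+ j * y) k : nat) = p ^ j * residue y k %[mod p ^ k.+1].
  rewrite -natrX -[residue _ k]/(residue _ k * residue y k) residue_nat val_Zpow_mul//.
  by rewrite -modnMml Zpow_mod_val// modnMml.
apply: (iffP idP) => [|[y ->]]; last first.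
  rewrite /dvdn -(modn_dvdm _ (dvdn_exp2l p ik)) mulE modn_dvdm ?dvdn_exp2l//.
  by rewrite modnMr.
elim: i ik => [|i IH] ik; first by exists x; rewrite expr0 mul1r.
move=> dvx; have [|y xE] := IH (ltnW ik).
  by apply: dvdn_trans dvx; rewrite dvdn_exp2l.
have : (p %| residue y k)%N.
  have := dvx; rewrite xE /dvdn -(modn_dvdm _ (dvdn_exp2l p ik)) mulE modn_dvdm ?dvdn_exp2l//.
  by rewrite -/(dvdn _ _) expnSr dvdn_pmul2l// expn_gt0 prime_gt0.
move=> /residue0_dvd/padic_divp[z yE].
by exists z; rewrite xE yE mulrA exprSr.
Qed.

Lemma leq_padic_valP i x : x != 0 -> reflect (exists y, x = p%:R ^+ i * y) (i <= padic_val x)%N.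
Proof.
move=> x0; apply: (iffP idP) => [iv|[z zE]]; have [[y yE] nz] := padic_valP p_gt1 x0.
  by exists (p%:R ^+ (padic_val x - i) * y); rewrite mulrA -exprD subnKC.
rewrite leqNgt; apply/negP => vi; apply: nz.
by exists (p%:R ^+ (i - (padic_val x).+1) * z); rewrite mulrA -exprD subnKC.
Qed.

(** In this form the truncations visibly increase with k and are eventually equal to |x|, as
    monotone convergence requires. *)
Lemma trunc_abs_residue x k :
  trunc_abs R p k.+1 (residue x k) = if (padic_val x <= k)%N then padic_abs R x else 0.
Proof.
(* The valuation of 0 is an arbitrary value of [get], but both branches are then 0. *)
rewrite /padic_abs; have [->|x0] := eqVneq x 0.
  by rewrite if_same /trunc_abs big1// => i _; rewrite !dvdn0 mul0r.
have E i : (i <= k.+1)%N -> (p ^ i %| residue x k)%N = (i <= padic_val x)%N.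
  by move=> ik; apply/(dvdn_residueP _ ik)/leq_padic_valP.
rewrite /trunc_abs.
(* The condition on i becomes i <= v < i+1 with v the valuation, so only i = v can contribute. *)
under eq_bigr => i _.
  rewrite (E i (ltnW (ltn_ord i))) (E i.+1 (ltn_ord i)) -leqNgt -eqn_leq.
  over.
case: ifPn => vk; last first.
  rewrite big1// => i _; case: eqP => [iv|]; rewrite ?mul0r//.
  by move: vk; rewrite -iv -ltnS ltn_ord.
rewrite (bigD1 (Ordinal (vk : (padic_val x < k.+1)%N)))//= eqxx mul1r big1 ?addr0// => i iv.
by rewrite (_ : _ == _ = false) ?mul0r//; apply: contraNF iv => /eqP iv; apply/eqP/val_inj.
Qed.

Lemma padic_abs_ge0 x : 0 <= padic_abs R x.
Proof. by rewrite /padic_abs; case: ifP => // _; rewrite invr_ge0 exprn_ge0. Qed.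

End Valuation.

(** * Random p-adic matrices *)

Section FiniteValued.
Local Open Scope classical_set_scope.
Variables (d : measure_display) (T : measurableType d) (R : realType).
Variables (I : finType) (Y : T -> I) (f : I -> R).
Hypothesis mY : forall i, measurable (Y @^-1` [set i]).

(** Expanding over the fibres of [Y] makes this a simple function, with no sigma-algebra on [I]. *)
Let finite_valuedE w : f (Y w) = \sum_i f i * \1_(Y @^-1` [set i]) w.
Proof.
rewrite (bigD1 (Y w))//= indicE mem_set// mulr1 big1 ?addr0// => i iY.
by rewrite indicE memNset ?mulr0// => /= E; rewrite E eqxx in iY.
Qed.

Lemma measurable_finite_valued : measurable_fun setT (fun w => f (Y w)).
Proof.
under eq_fun do rewrite finite_valuedE.
by apply: measurable_sum => i; apply: measurable_funM => //; exact: measurable_indic.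
Qed.

Lemma integral_finite_valued (mu : {measure set T -> \bar R}) : (forall i, 0 <= f i) ->
  (\int[mu]_w (f (Y w))%:E = \sum_i (f i)%:E * mu (Y @^-1` [set i]))%E.
Proof.
move=> f0; under eq_integral => w _ do rewrite finite_valuedE -sumEFin.
rewrite ge0_integral_sum//; last first.
- by move=> i w _; rewrite lee_fin mulr_ge0// indicE.
- move=> i; apply/measurable_EFinP; apply: measurable_funM => //; exact: measurable_indic.
apply: eq_bigr => i _; under eq_integral => w _ do rewrite EFinM.
rewrite ge0_integralZl_EFin ?integral_indic ?setIT//.
by apply/measurable_EFinP; exact: measurable_indic.
Qed.

End FiniteValued.

(** * Haar measure of residue classes *)

Section HaarMeasure.
Local Open Scope classical_set_scope.
Variables (R : realType) (p : nat).
Hypothesis p_prime : prime p.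

Lemma measurable_residue k (a : 'Z_(p ^ k.+1)) :
  measurable ((fun x : padic_int p => residue x k) @^-1` [set a]).
Proof.
apply: sub_sigma_algebra.
suff: padic_open ((fun x : padic_int p => residue x k) @^-1` [set a]) by [].
by move=> x xa; exists k => y yx; rewrite /= yx.
Qed.

(** The p^(k+1) residue classes are translates of one another and partition Z_p, so they share the
    mass 1 equally. *)
Lemma haar_residue (mu : probability (padic_int p) R) k (a : 'Z_(p ^ k.+1)) :
  is_haar_probability mu ->
  mu ((fun x : padic_int p => residue x k) @^-1` [set a]) = ((p ^ k.+1)%:R^-1)%:E.
Proof.
move=> inv; set C := fun b : 'Z_(p ^ k.+1) => (fun x : padic_int p => residue x k) @^-1` [set b].
have E b : mu (C b) = mu (C a).
  (* The natural number representing b - a, embedded in Z_p, translates the class of a to that of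
     b. *)
  rewrite -(inv (b - a)%R%:R (C a)); last exact: measurable_residue.
  congr (mu _); apply/seteqP; split => [x xb|_ [x xa <-]] /=.
    exists (x - (b - a)%R%:R); last by rewrite addrC subrK.
    change (residue x k - residue (b - a)%R%:R k = a).
    by rewrite (xb : residue x k = b) residue_nat natr_Zp opprB addrC subrK.
  change (residue (b - a)%R%:R k + residue x k = b).
  by rewrite residue_nat natr_Zp (xa : residue x k = a) subrK.
have fin : mu (C a) \is a fin_num by apply: fin_num_measure; exact: measurable_residue.
have int1 : (\int[mu]_x (1 : R)%:E = 1)%E.
  by rewrite integral_cst// mul1e; exact: probability_setT.
(* Additivity over the partition is obtained by integrating the constant 1 as a function of the
   residue. *)
have : (\sum_(b : 'Z_(p ^ k.+1)) (fine (mu (C a)))%:E = 1)%E.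
  rewrite -[RHS]int1 (integral_finite_valued (f := fun=> 1) (@measurable_residue k))//.
  by apply: eq_bigr => b _; rewrite mul1e fineK//; exact/esym/E.
rewrite sumEFin sumr_const card_Zpow// => -[H].
rewrite -/(C a) -(fineK fin); congr EFin.
have p0 : (p ^ k.+1)%:R != 0 :> R by rewrite pnatr_eq0 expn_eq0 negb_and -lt0n prime_gt0.
by apply: (mulfI p0); rewrite mulr_natl H divff.
Qed.

End HaarMeasure.

(** * From residue matrices to the expectation *)

Section RandomMatrix.
Local Open Scope classical_set_scope.
Variables (R : realType) (d : measure_display) (T : measurableType d).
Variables (P : probability T R) (p n : nat).
Hypothesis p_prime : prime p.
Variable M : 'I_n -> 'I_n -> {RV P >-> padic_int p}.
Hypothesis M_indep : mutually_independent (fun ij : 'I_n * 'I_n => M ij.1 ij.2).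
Hypothesis M_unif : forall i j : 'I_n, uniform_padic (M i j).

Definition residue_mx k (w : T) : 'M['Z_(p ^ k.+1)]_n :=
  \matrix_(i, j) residue (M i j w) k.

Lemma residue_det k w :
  residue (\det (\matrix_(i < n, j < n) M i j w)) k = \det (residue_mx k w).
Proof.
rewrite -[LHS]/(padic_residue k _) -det_map_mx; congr determinant.
by apply/matrixP => i j; rewrite !mxE.
Qed.

Let cell k (A : 'M['Z_(p ^ k.+1)]_n) (ij : 'I_n * 'I_n) : set (padic_int p) :=
  (fun x : padic_int p => residue x k) @^-1` [set A ij.1 ij.2].

(** The intersection over the full index set is the shape to which [mutually_independent]
    applies. *)
Let preimage_residue_mx k A : residue_mx k @^-1` [set A] =
  \bigcap_(ij in [set` [set: 'I_n * 'I_n]%SET]) (M ij.1 ij.2 @^-1` cell A ij).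
Proof.
apply/seteqP; split => [w /= <- [i j] _ /=|w H].
  by rewrite /cell /= mxE.
by apply/matrixP => i j; rewrite mxE; apply: (H (i, j)); rewrite /= inE.
Qed.

Lemma measurable_residue_mx k A : measurable (residue_mx k @^-1` [set A]).
Proof.
rewrite preimage_residue_mx; apply: fin_bigcap_measurable => //.
by move=> ij _; apply: measurable_funPTI; exact: measurable_residue.
Qed.

Lemma residue_mx_uniform k A :
  P (residue_mx k @^-1` [set A]) = ((p ^ k.+1)%:R ^- (n * n))%:E.
Proof.
rewrite preimage_residue_mx M_indep; last by move=> ij; exact: measurable_residue.
rewrite (eq_bigr (fun=> ((p ^ k.+1)%:R^-1)%:E)); last first.
  by move=> ij _; exact: (haar_residue p_prime _ (M_unif ij.1 ij.2)).
by rewrite prodEFin prodr_const cardsT card_prod !card_ord exprVn.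
Qed.

(** Truncation k+1 is the finest that residues mod p^(k+1) determine. *)
Lemma integral_trunc_abs_det k :
  (\int[P]_w (trunc_abs R p k.+1 (\det (residue_mx k w)))%:E = (det_mean R p k n k.+1)%:E)%E.
Proof.
pose f (A : 'M['Z_(p ^ k.+1)]_n) := trunc_abs R p k.+1 (\det A).
rewrite (integral_finite_valued (f := f) (@measurable_residue_mx k)); last first.
  by move=> A; exact: trunc_abs_ge0.
rewrite /det_mean /det_sum mulr_suml -sumEFin; apply: eq_bigr => A _.
by rewrite [X in (_ * X)%E](residue_mx_uniform A) -EFinM.
Qed.

(** Modulus and truncation grow together; this is harmless because the bound p^-j of
    [det_mean_bound] does not depend on the modulus. *)
Lemma cvg_det_mean : (fun k => det_mean R p k n k.+1) @ \oo --> det_limit R p n.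
Proof.
apply/cvgrPdist_le => e e0.
have q1 : `|p%:R^-1| < 1 :> R.
  by rewrite ger0_norm ?invr_ge0// invf_lt1 ?ltr1n ?ltr0n ?prime_gt1 ?prime_gt0.
have /cvgrPdist_le/(_ e e0) := cvg_expr q1.
apply: filterS => k; rewrite sub0r normrN normrX => qk.
rewrite (le_trans (det_mean_bound _ p_prime _ (leqnn k.+1)))// (le_trans _ qk)//.
rewrite -exprVn -[X in X ^+ _ <= _]ger0_norm ?invr_ge0//.
by rewrite ler_wiXn2l// ltW.
Qed.

Lemma expectation_padic_abs_det :
  ('E_P[fun w : T => padic_abs R (\det (\matrix_(i < n, j < n) M i j w))]
    = (det_limit R p n)%:E)%E.
Proof.
pose g k (w : T) : \bar R := (trunc_abs R p k.+1 (\det (residue_mx k w)))%:E.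
have gE k w : g k w = (if (padic_val (\det (\matrix_(i < n, j < n) M i j w)) <= k)%N
    then padic_abs R (\det (\matrix_(i < n, j < n) M i j w)) else 0)%:E.
  by rewrite /g -residue_det trunc_abs_residue.
rewrite unlock; transitivity (\int[P]_w limn (g ^~ w))%E.
  apply: eq_integral => w _; apply/esym/cvg_lim => //.
  (* For fixed w the sequence is constant once k reaches the valuation; a zero determinant is no
     exception, all terms being 0. *)
  apply: cvg_near_cst; exists (padic_val (\det (\matrix_(i < n, j < n) M i j w))) => // k /= vk.
  by rewrite gE vk.
rewrite monotone_convergence//.
- apply/cvg_lim => //; under eq_fun do rewrite integral_trunc_abs_det.
  by apply: cvg_EFin; [exact: nearW|exact: cvg_det_mean].
- move=> k; apply/measurable_EFinP.
  pose f (A : 'M['Z_(p ^ k.+1)]_n) := trunc_abs R p k.+1 (\det A).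
  exact: (measurable_finite_valued f (@measurable_residue_mx k)).
- by move=> k w _; rewrite lee_fin trunc_abs_ge0.
- move=> w _ k l kl; rewrite !gE lee_fin; case: ifPn => vk.
    by rewrite (leq_trans vk kl).
  by case: ifPn => // _; exact: padic_abs_ge0.
Qed.

End RandomMatrix.

Theorem corollary12 (R : realType) (d : measure_display) (T : measurableType d)
    (P : probability T R) (p n : nat) (p_prime : prime p) (n_ge1 : (1 <= n)%N)
    (M : 'I_n -> 'I_n -> {RV P >-> padic_int p})
    (M_indep : mutually_independent (fun ij : 'I_n * 'I_n => M ij.1 ij.2))
    (M_unif : forall i j : 'I_n, uniform_padic (M i j)) :
  ('E_P[fun w : T => padic_abs R (\det (\matrix_(i < n, j < n) M i j w))]
    = (((p%:R - 1) * p%:R ^+ n / (p%:R ^+ n.+1 - 1))%:E))%E.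
Proof. exact: expectation_padic_abs_det. Qed.
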